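(* Let $n$ and $k$ be integers with $2\leq k\leq n$. For any graph $G$ of order $n$ with complement $\overline{G}$, we have (1) $1\leq \kappa_k(G)+\kappa_k(\overline{G})\leq n-\lceil k/2\rceil$; (2) $0\leq \kappa_k(G)\cdot \kappa_k(\overline{G})\leq \left(\frac{n-\lceil k/2\rceil}{2}\right)^2$. Moreover, the upper and lower bounds are tight: for each of these four bounds there exist $n$, $k$ and a graph $G$ of order $n$ for which the bound is attained with equality.
   Context: All graphs are undirected, finite and simple. For a graph $G$ and a set $S\subseteq V(G)$ of at least two vertices, a tree connecting $S$ is a subgraph $T$ of $G$ that is a tree with $S\subseteq V(T)$. Two trees $T,T'$ connecting $S$ are internally disjoint if $E(T)\cap E(T')=\varnothing$ and $V(T)\cap V(T')=S$. Let $\kappa(S)$ be the maximum number of pairwise internally disjoint trees connecting $S$ in $G$. The generalized $k$-connectivity of $G$ is $\kappa_k(G)=\min\{\kappa(S) : S\subseteq V(G),\ |S|=k\}$, with $\kappa_k(G)=0$ when $G$ is disconnected. *)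

(* Defs.v *)
From mathcomp Require Import all_boot.

Set Implicit Arguments.
Unset Strict Implicit.
Unset Printing Implicit Defensive.

Record sgraph (V : finType) := SGraph {
  adj :> rel V;
  adj_sym : symmetric adj;
  adj_irr : irreflexive adj
}.

Section Complement.
Variables (V : finType) (G : sgraph V).

Definition compl_adj : rel V := [rel x y | (x != y) && ~~ G x y].

Lemma compl_adj_sym : symmetric compl_adj.
Proof. by move=> x y; rewrite /compl_adj /= eq_sym adj_sym. Qed.

Lemma compl_adj_irr : irreflexive compl_adj.
Proof. by move=> x; rewrite /compl_adj /= eqxx. Qed.

Definition compl_graph : sgraph V := SGraph compl_adj_sym compl_adj_irr.

End Complement.

Section GeneralizedConnectivity.
Variable V : finType.

Definition edges (G : sgraph V) : {set {set V}} :=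
  [set [set p.1; p.2] | p : V * V & G p.1 p.2].

(* Used below only for relations e both of whose ends lie in U, so that the
   paths witnessing [connect] stay inside U. *)
Definition connected_on (U : {set V}) (e : rel V) : bool :=
  (U != set0) && [forall x in U, forall y in U, connect e x y].

Definition connected_graph (G : sgraph V) : bool := connected_on setT G.

(* A cycle has at least 3 distinct vertices; sequences without repetition have
   length at most #|V|, so bounding the length (to get a boolean) loses none. *)
Definition acyclic (e : rel V) : bool :=
  [forall m : 'I_#|V|.+1, forall c : m.-tuple V, (2 < m) ==> ~~ ucycleb e c].

Lemma acyclicP (e : rel V) :
  reflect (forall c : seq V, 2 < size c -> ~ ucycle e c) (acyclic e).
Proof.
apply: (iffP forallP) => [ac c c_gt2 uc | ac m].
  have lt_c : size c < #|V|.+1.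
    by case/andP: uc => _ /card_uniqP <-; rewrite ltnS max_card.
  have /forallP/(_ (in_tuple c)) := ac (Ordinal lt_c).
  by rewrite /= c_gt2 /= => /negP; apply.
apply/forallP=> c; apply/implyP=> m_gt2; apply/negP=> uc.
by apply: (ac c) => //; rewrite size_tuple.
Qed.

(* A pair (U, F) of a vertex set and an edge set. *)
Definition subgr : finType := ({set V} * {set {set V}})%type.

Definition subgr_adj (T : subgr) : rel V := [rel x y | [set x; y] \in T.2].

Definition is_subgraph (G : sgraph V) (T : subgr) : bool :=
  (T.2 \subset edges G) && [forall f in T.2, f \subset T.1].

Definition is_tree (T : subgr) : bool :=
  connected_on T.1 (subgr_adj T) && acyclic (subgr_adj T).

Definition connecting_tree (G : sgraph V) (S : {set V}) (T : subgr) : bool :=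
  [&& is_subgraph G T, is_tree T & S \subset T.1].

Definition internally_disjoint (S : {set V}) (T1 T2 : subgr) : bool :=
  (T1.2 :&: T2.2 == set0) && (T1.1 :&: T2.1 == S).

Definition disjoint_tree_family
    (G : sgraph V) (S : {set V}) (A : {set subgr}) : bool :=
  [forall T in A, connecting_tree G S T] &&
  [forall T1 in A, forall T2 in A, (T1 != T2) ==> internally_disjoint S T1 T2].

Definition kappa (G : sgraph V) (S : {set V}) : nat :=
  \max_(A : {set subgr} | disjoint_tree_family G S A) #|A|.

(* [minn] has no neutral element in nat; starting from the maximum of the same
   family makes the iterated [minn] its minimum as soon as k <= #|V|. *)
Definition gen_connectivity (k : nat) (G : sgraph V) : nat :=
  if connected_graph G then
    \big[minn/(\max_(S : {set V} | #|S| == k) kappa G S)]_(S : {set V}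
      | #|S| == k) kappa G S
  else 0.

End GeneralizedConnectivity.

(* Main.v *)
Require Import Defs.
From mathcomp Require Import all_boot all_order all_algebra.
From mathcomp Require Import zify lra.

(** For both graphs together, fix S with k vertices and collect internally
    disjoint trees of G and of its complement connecting S: they are pairwise
    edge-disjoint in the complete graph.  Orienting a tree towards a root
    gives k distinct edges meeting S if the tree has a vertex outside S (which
    is taken as the root), and k - 1 edges inside S otherwise.  With m1 trees
    on S and m2 others, [(k - 1) m1 <= 'C(k, 2)] and
    [(k - 1) m1 + k m2 <= 'C(n, 2) - 'C(n - k, 2)], hence
    [m1 + m2 <= n - uphalf k].  The lower bound holds because G or its
    complement is connected, and a connected graph has a spanning tree.  Both
    bounds on the sum coincide for n = k = 2; the product bound is attained by
    the self-complementary path on 4 vertices with k = 3. *)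

Set Implicit Arguments.
Unset Strict Implicit.
Unset Printing Implicit Defensive.

(** * Distance to a root, and two counting tools *)

Lemma exists_parent (T : finType) (e : rel T) (r : T) :
  exists (d : T -> nat) (p : T -> T), forall x, connect e x r -> x != r ->
    e x (p x) /\ d (p x) < d x.
Proof.
(* [P x n] says that a walk of length [n] leads from [x] to [r]. The function [d] is the distance to
   [r], and [p x] the second vertex of a shortest walk. Off the component of [r] the values are
   arbitrary. *)
pose P x n := exists2 s, path e x s & last x s = r /\ size s = n.
have /fin_all_exists[d dP] : forall x, exists n, connect e x r ->
    P x n /\ forall m, P x m -> n <= m.
  move=> x; have [|nc] := boolP (connect e x r); last by exists 0.
  case/connectP=> s es rs.
  pose Q n := [exists t : n.-tuple T, path e x t && (last x t == r)].
  have PQ n : reflect (P x n) (Q n).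
    apply: (iffP existsP) => [[t /andP[et /eqP lt]]|[t et [lt <-]]].
      by exists t; rewrite ?size_tuple.
    by exists (in_tuple t); rewrite et lt eqxx.
  have exQ : exists n, Q n by exists (size s); apply/PQ; exists s.
  exists (ex_minn exQ) => _; case: ex_minnP => n /PQ Pn min_n.
  by split=> // m /PQ /min_n.
have /fin_all_exists[p pP] : forall x, exists y, connect e x r -> x != r ->
    e x y /\ d y < d x.
  move=> x; have [cx|nc] := boolP (connect e x r); last by exists x.
  have [[[|y s] /= es [ls zs]] _] := dP x cx.
    by exists x => _; rewrite ls eqxx.
  case/andP: es => exy es; exists y => _ _.
  have cy : connect e y r by apply/connectP; exists s.
  by split=> //; rewrite -zs ltnS; apply: (dP y cy).2; exists s.
by exists d, p.
Qed.

(** Double counting: after exchanging the sums, each element of [D] contributes at most 1, since it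
    lies in at most one [F i]. *)
Lemma sum_card_disjoint (I T : finType) (B : {set I}) (F : I -> {set T})
    (D : {set T}) :
  {in B, forall i, F i \subset D} ->
  {in B &, forall i j, i != j -> F i :&: F j = set0} ->
  \sum_(i in B) #|F i| <= #|D|.
Proof.
move=> subD disj.
rewrite -[leqRHS]sum1_card (eq_bigr (fun i => \sum_(f in D) (f \in F i))).
  rewrite exchange_big /=; apply: leq_sum => f _.
  have [i /andP[iB fi]|none] := pickP [pred i in B | f \in F i].
    rewrite (bigD1 i) //= fi big1 // => j /andP[jB ji].
    apply/eqP; rewrite eqb0; apply/negP=> fj.
    by have /setP/(_ f) := disj j i jB iB ji; rewrite !inE fi fj.
  rewrite big1 // => i iB.
  by have := none i; rewrite /= iB /= => ->.
move=> i iB; rewrite -sum1_card -big_mkcondr /=.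
apply: eq_bigl => f; case fi: (f \in F i); rewrite ?andbF //.
by rewrite (subsetP (subD i iB)).
Qed.

Lemma pairs_meeting_card (V : finType) (S : {set V}) :
  #|[set f : {set V} | (#|f| == 2) && (f :&: S != set0)]|
    = 'C(#|V|, 2) - 'C(#|V| - #|S|, 2).
Proof.
have -> : #|V| - #|S| = #|~: S| by have := cardsC S; lia.
rewrite -(cards_draws (~: S) 2) -cardsT -(cards_draws setT 2).
rewrite -cardsDS; last by apply/subsetP=> f; rewrite !inE subsetT => /andP[].
apply: eq_card => f; rewrite !inE subsetT -disjoints_subset -setI_eq0 /=.
by rewrite andbC; case: (#|f| == 2); rewrite ?andbF ?andbT.
Qed.

Section Counting.
Variable V : finType.
Implicit Types (G : sgraph V) (S U : {set V}) (F : {set {set V}}) (T : subgr V).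

(** * Counting the edges of connecting trees that meet [S] *)

Lemma subgr_adj_sym T : symmetric (subgr_adj T).
Proof. by move=> x y; rewrite /subgr_adj /= setUC. Qed.

(** Each [x] in [S] other than [r] is charged the edge to its parent. Two vertices sharing that edge
    would be parents of each other, against the strict decrease of [d]. The count is the full [#|S|]
    when [r] is outside [S], and one less when it is inside. *)
Lemma leq_incident_edges T S (r : V) :
  connected_on T.1 (subgr_adj T) -> S \subset T.1 -> r \in T.1 ->
  #|S :\ r| <= #|[set f in T.2 | f :&: S != set0]|.
Proof.
case/andP=> _ /forall_inP conT sST rT.
have [d [p dp]] := exists_parent (subgr_adj T) r.
have dpS x : x \in S :\ r -> [set x; p x] \in T.2 /\ d (p x) < d x.
  case/setD1P=> xr xS; have xT := subsetP sST _ xS.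
  by have [] := dp x (forall_inP (conT x xT) r rT) xr.
rewrite -(card_in_imset (f := fun x => [set x; p x])).
  apply/subset_leq_card/subsetP=> _ /imsetP[x xS ->].
  rewrite inE (dpS x xS).1; apply/set0Pn; exists x.
  by case/setD1P: xS => _ xS; rewrite !inE eqxx.
move=> x y xS yS exy; have [_ dx] := dpS x xS; have [_ dy] := dpS y yS.
have: x \in [set y; p y] by rewrite -exy !inE eqxx.
have: y \in [set x; p x] by rewrite exy !inE eqxx.
rewrite !inE => /orP[/eqP->//|/eqP ypx] /orP[/eqP//|/eqP xpy].
by move: dx dy; rewrite -ypx -xpy => /ltn_trans H /H; rewrite ltnn.
Qed.

(** No host graph is mentioned, so that the bound applies to trees of a graph and of its complement
    taken together. *)
Lemma card_edge_disjoint_connectors S (B : {set subgr V}) :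
  1 < #|S| ->
  {in B, forall T, [/\ connected_on T.1 (subgr_adj T), S \subset T.1
     & {in T.2, forall f : {set V}, #|f| = 2 /\ f \subset T.1}]} ->
  {in B &, forall T1 T2, T1 != T2 -> T1.2 :&: T2.2 = set0} ->
  #|B| <= #|V| - uphalf #|S|.
Proof.
move=> S2 conB disj.
pose I T := [set f in T.2 | f :&: S != set0].
pose B1 := [set T in B | T.1 == S]; pose B2 := B :\: B1.
have S0 : S != set0 by rewrite -card_gt0; lia.
have B1B : B1 \subset B by apply/subsetP=> T /setIdP[].
have cB : #|B| = #|B1| + #|B2| by rewrite /B2 cardsDS // subnKC // subset_leq_card.
have disjI : {in B &, forall T1 T2, T1 != T2 -> I T1 :&: I T2 = set0}.
  move=> T1 T2 h1 h2 ne; apply/eqP; rewrite -subset0 -(disj _ _ h1 h2 ne).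
  by rewrite setISS //; apply/subsetP=> f /setIdP[].
have I1 T : T \in B1 -> #|S|.-1 <= #|I T|.
  case/setIdP=> TB /eqP TS; have [cT sT _] := conB T TB.
  case/set0Pn: S0 => r rS; apply: leq_trans (leq_incident_edges cT sT (subsetP sT _ rS)).
  by rewrite (cardsD1 r S) rS.
(* A vertex of the tree outside [S] serves as root, so no vertex of [S] is lost. *)
have I2 T : T \in B2 -> #|S| <= #|I T|.
  case/setDP=> TB; rewrite inE TB /= => TS; have [cT sT _] := conB T TB.
  have: ~~ (T.1 \subset S) by apply: contra TS => TsubS; rewrite eqEsubset TsubS.
  case/subsetPn=> r rT rS; apply: leq_trans (leq_incident_edges cT sT rT).
  rewrite subset_leq_card //; apply/subsetP=> x xS; rewrite !inE xS andbT.
  by apply: contraNneq rS => <-.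
(* The trees of [B1] have all their edges inside [S], which leaves only 'C(k, 2) pairs for them. *)
have le1 : #|B1| * #|S|.-1 <= 'C(#|S|, 2).
  rewrite -sum_nat_const -cards_draws.
  apply: (@leq_trans (\sum_(T in B1) #|I T|)); first exact: leq_sum.
  apply: sum_card_disjoint.
    move=> T /setIdP[TB /eqP <-]; have [_ _ fT] := conB T TB.
    by apply/subsetP=> f /setIdP[/fT[f2 fs] _]; rewrite inE fs f2 eqxx.
  by move=> T1 T2 /(subsetP B1B) h1 /(subsetP B1B) h2; apply: disjI.
have le2 : #|B1| * #|S|.-1 + #|B2| * #|S| <= 'C(#|V|, 2) - 'C(#|V| - #|S|, 2).
  rewrite -pairs_meeting_card -!sum_nat_const.
  apply: (@leq_trans (\sum_(T in B) #|I T|)).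
    rewrite [leqRHS](big_setID B1) /= (setIidPr B1B).
    by apply: leq_add; apply: leq_sum.
  apply: sum_card_disjoint disjI => T TB; have [_ _ fT] := conB T TB.
  by apply/subsetP=> f /setIdP[/fT[f2 _] fS]; rewrite inE fS f2 eqxx.
have := max_card (mem S); rewrite -[#|mem S|]/#|S| cB => kn.
move: le1 le2 kn S2; move: #|B1| #|B2| #|S| #|V| => m1 m2 k n.
move=> le1 le2 kn k2; have [j nE] : exists j, n = k + j by exists (n - k); lia.
have bin2_double m : 'C(m, 2) * 2 = m * m.-1.
  by rewrite bin2 muln2 -[RHS]odd_double_half; case: m => //= m; rewrite oddM /= andNb.
move: le1 le2; rewrite nE addKn => le1 le2.
have b1 := bin2_double k; have b2 := bin2_double j; have b3 := bin2_double (k + j).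
have m1k : 2 * m1 <= k.
  have : k.-1 * (2 * m1) <= k.-1 * k by lia.
  by rewrite leq_pmul2l //; lia.
(* Doubling [le2] gives 2(k - 1) m1 + 2k m2 <= k(k - 1) + 2kj; adding 2 m1 <= k yields the claim.
   After division by k, 2(m1 + m2) <= 2n - k, and integrality produces [uphalf k]. *)
have : k * (2 * (m1 + m2)) <= k * (k + 2 * j).
  case: k k2 {kn nE} le1 le2 b1 b3 m1k => //= k _ le1 le2 b1 b3 m1k.
  (* The case [j = 0] is separate because [j.-1] is truncated there. *)
  case: j le2 b2 b3 => [|j] /= le2 b2 b3; rewrite ?addn0 /= in b3 le2 *; nia.
rewrite leq_pmul2l; lia.
Qed.

(** * The upper bound for a graph and its complement *)

Lemma edgesP G x y : ([set x; y] \in edges G) = G x y.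
Proof.
apply/imsetP/idP=> [[[a b]]|Gxy]; last by exists (x, y); rewrite ?inE.
rewrite !inE /= => Gab e.
have ab : a != b by apply: contraTneq Gab => ->; rewrite adj_irr.
have: a \in [set x; y] by rewrite e !inE eqxx.
have: b \in [set x; y] by rewrite e !inE eqxx orbT.
rewrite !inE => /orP[] /eqP eb /orP[] /eqP ea; move: ab Gab; rewrite ea eb ?eqxx //.
by rewrite adj_sym.
Qed.

Lemma edge_card2 G f : f \in edges G -> #|f| = 2.
Proof.
case/imsetP=> [[a b]]; rewrite !inE /= => Gab ->.
by rewrite cards2; case: eqVneq Gab => // ->; rewrite adj_irr.
Qed.

Lemma edges_compl_disjoint G f :
  f \in edges G -> f \in edges (compl_graph G) -> False.
Proof.
by move=> fG /imsetP[[a b]]; rewrite !inE /= => /andP[_ nab] fE; rewrite fE edgesP (negPf nab) in fG.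
Qed.

Lemma connecting_tree_connector G S T : connecting_tree G S T ->
  [/\ connected_on T.1 (subgr_adj T), S \subset T.1,
      T.2 \subset edges G & {in T.2, forall f : {set V}, #|f| = 2 /\ f \subset T.1}].
Proof.
case/and3P=> /andP[sE /forall_inP sF] /andP[cT _] sT; split=> // f fT.
by split; [apply/(edge_card2 (G := G))/(subsetP sE) | apply: sF].
Qed.

Lemma kappa_attained G S :
  exists2 A : {set subgr V}, disjoint_tree_family G S A & kappa G S = #|A|.
Proof.
have [|A ? ?] := @eq_bigmax_cond _ (disjoint_tree_family G S) (fun A : {set subgr V} => #|A|).
  (* The empty family qualifies, so the maximum ranges over a nonempty collection and is
     attained. *)
  apply/card_gt0P; exists set0; rewrite unfold_in /=; apply/andP.
  by split; apply/forall_inP=> T; rewrite inE.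
by exists A.
Qed.

Lemma kappa_compl_sum G S : 1 < #|S| ->
  kappa G S + kappa (compl_graph G) S <= #|V| - uphalf #|S|.
Proof.
move=> S2.
have [A /andP[/forall_inP At /forall_inP Ad] ->] := kappa_attained G S.
have [A' /andP[/forall_inP A't /forall_inP A'd] ->] := kappa_attained (compl_graph G) S.
have cross T T' : T \in A -> T' \in A' -> T.2 :&: T'.2 = set0.
  move=> /At/connecting_tree_connector[_ _ s _] /A't/connecting_tree_connector[_ _ s' _].
  apply/setP=> f; rewrite !inE; apply/negP=> /andP[/(subsetP s) fT /(subsetP s') fT'].
  exact: edges_compl_disjoint fT fT'.
(* A common tree would have no edge, yet it joins at least two vertices of [S]. Hence the union of
   the two families has the sum of their sizes. *)
have AA' : A :&: A' = set0.
  apply/setP=> T; rewrite !inE; apply/negP=> /andP[TA TA'].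
  have [cT sT _ _] := connecting_tree_connector (At T TA).
  have [r rS] : exists r, r \in S by apply/card_gt0P; lia.
  have := leq_incident_edges cT sT (subsetP sT r rS).
  have -> : T.2 = set0 by rewrite -(cross T T TA TA') setIid.
  rewrite (_ : [set f in set0 | _] = set0) ?cards0; last by apply/setP=> f; rewrite !inE.
  by have := cardsD1 r S; rewrite rS; lia.
rewrite -cardsUI AA' cards0 addn0; apply: card_edge_disjoint_connectors => //.
  by move=> T /setUP[/At|/A't] /connecting_tree_connector[].
move=> T T' /setUP[TA|TA'] /setUP[T'A|T'A'] ne.
- by have /forall_inP/(_ T' T'A) := Ad T TA; rewrite ne => /andP[/eqP].
- exact: cross.
- by rewrite setIC; apply: cross.
- by have /forall_inP/(_ T' T'A') := A'd T TA'; rewrite ne => /andP[/eqP].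
Qed.

Lemma gen_connectivity_le_kappa k G S :
  #|S| = k -> gen_connectivity k G <= kappa G S.
Proof.
move=> /eqP Sk; rewrite /gen_connectivity; case: ifP => // _.
have : S \in [seq S' : {set V} <- index_enum _ | #|S'| == k].
  by rewrite mem_filter Sk mem_index_enum.
rewrite -big_filter; elim: [seq _ <- _ | _] => // T s IH.
rewrite inE big_cons => /predU1P[->|/IH]; first exact: geq_minl.
exact: leq_trans (geq_minr _ _).
Qed.

Lemma gen_connectivity_compl_sum k G : 2 <= k -> k <= #|V| ->
  gen_connectivity k G + gen_connectivity k (compl_graph G) <= #|V| - uphalf k.
Proof.
move=> k2 kn.
have [S Sk] : exists S : {set V}, #|S| = k.
  have /card_gt0P[S] : 0 < #|[set S : {set V} | #|S| == k]|.
    by rewrite card_draws bin_gt0.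
  by rewrite inE => /eqP; exists S.
rewrite -Sk; apply: leq_trans (kappa_compl_sum G _); last by rewrite Sk.
by apply: leq_add; apply: gen_connectivity_le_kappa.
Qed.

(** * The lower bound: connectedness and spanning trees *)

Lemma connected_from G (r : V) :
  (forall x, connect G r x) -> connected_graph G.
Proof.
move=> cr; apply/andP; split; first by apply/set0Pn; exists r.
apply/forall_inP=> x _; apply/forall_inP=> y _.
by apply: connect_trans (cr y); rewrite (sym_connect_sym (@adj_sym _ G)).
Qed.

(** If [w] is unreachable from [v] in [G], then in the complement every vertex unreachable from [v]
    is adjacent to [v], and every reachable one is adjacent to [w], itself a neighbour of [v]. *)
Lemma connected_or_compl G : 0 < #|V| ->
  connected_graph G || connected_graph (compl_graph G).
Proof.
move=> /card_gt0P[v _]; have [//|ncG] := boolP (connected_graph G).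
have symG := sym_connect_sym (@adj_sym _ G).
have [w nvw] : exists w, ~~ connect G v w.
  apply/existsP; rewrite -negb_forall; apply: contra ncG => /forallP.
  exact: connected_from.
have far x y : ~~ connect G x y -> compl_graph G x y.
  move=> nxy; apply/andP; split; first by apply: contraNneq nxy => ->.
  by apply: contra nxy; apply: connect1.
apply: (@connected_from _ v) => x.
have [cvx|] := boolP (connect G v x); last by move/far/connect1.
apply: connect_trans (connect1 (far _ _ nvw)) (connect1 (far _ _ _)).
by apply: contra nvw; rewrite symG; apply: connect_trans.
Qed.

(** On a cycle, a vertex of maximal [d] would have both neighbours equal to its parent, although a
    cycle of length at least 3 has them distinct. *)
Lemma acyclic_parent_edges (d : V -> nat) (p : V -> V) (A : {set V}) U :
  {in A, forall x, d (p x) < d x} ->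
  acyclic (subgr_adj (U, [set [set x; p x] | x in A])).
Proof.
move=> dp; set T := (U, _).
have up x y : subgr_adj T x y -> d y <= d x -> y = p x.
  case/imsetP=> z zA e; have dz := dp z zA => dyx.
  have: x \in [set z; p z] by rewrite -e !inE eqxx.
  have: y \in [set z; p z] by rewrite -e !inE eqxx orbT.
  have: z \in [set x; y] by rewrite e !inE eqxx.
  have: p z \in [set x; y] by rewrite e !inE eqxx orbT.
  rewrite !inE => /orP[] /eqP e1 /orP[] /eqP e2 _ _; move: dz;
    rewrite e1 -?e2 //; move: e1; rewrite e2 => e1; rewrite ?e1 ?ltnn //.
  by move=> dxy; have := leq_trans dxy dyx; rewrite ltnn.
apply/acyclicP=> c c2 uc.
have [x0 x0c] : exists x, x \in c by case: c c2 {uc} => // x c; exists x; rewrite mem_head.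
case: (@arg_maxnP V x0 (mem c) d x0c) => x xc maxx.
(* Rotating the cycle puts the maximal vertex [x] first; its neighbours are then the second entry
   [y] and the last entry. *)
case/rot_to: (xc) => i s rs.
have: ucycle (subgr_adj T) (rot i c) by rewrite /ucycle rot_cycle rot_uniq.
have: 2 < size (rot i c) by rewrite size_rot.
have {}maxx y : y \in rot i c -> d y <= d x by rewrite mem_rot => /maxx.
rewrite {}rs in maxx *; case: s maxx => [//|y [//|z s]] maxx _.
have lz : last z s \in z :: s by apply: mem_last.
case/andP; rewrite /= rcons_path => /and4P[exy _ _ elx] /and3P[_ ynotin _].
have yE : y = p x by apply: up => //; apply: maxx; rewrite !inE eqxx orbT.
have lE : last z s = p x.
  apply: up; first by rewrite subgr_adj_sym.
  by apply: maxx; rewrite 2!inE lz !orbT.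
by move: ynotin; rewrite yE -lE lz.
Qed.

(** The edges from each vertex to its parent, for the distance to a fixed root, form a spanning
    tree; following parents reaches the root by induction on [d]. *)
Lemma exists_spanning_tree G S : connected_graph G ->
  exists T, connecting_tree G S T.
Proof.
case/andP=> /set0Pn[r _] /forall_inP conG.
have cG x y : connect G x y by apply: (forall_inP (conG x _)); rewrite inE.
have [d [p dp]] := exists_parent G r.
exists (setT, [set [set x; p x] | x in [set~ r]]).
have xr x : x \in [set~ r] -> x != r by rewrite !inE.
apply/and3P; split; last exact: subsetT.
  apply/andP; split; last by apply/forall_inP=> f _; apply: subsetT.
  apply/subsetP=> _ /imsetP[x /xr xr' ->]; rewrite edgesP.
  by have [] := dp x (cG _ _) xr'.
apply/andP; split; last first.
  by apply: acyclic_parent_edges (d) _ _ _ _ => x /xr; case/(dp x (cG _ _)).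
set T := (_, _).
have cT m x : d x < m -> connect (subgr_adj T) x r.
  elim: m x => // m IH x; rewrite ltnS => dx.
  have [->//|ne] := eqVneq x r; have [_ lt] := dp x (cG _ _) ne.
  apply: connect_trans (IH _ (leq_trans lt dx)); apply: connect1.
  by apply/imsetP; exists x; rewrite ?inE.
apply/andP; split; first by apply/set0Pn; exists r.
apply/forall_inP=> x _; apply/forall_inP=> y _.
apply: connect_trans (cT _ x (leqnn _)) _.
by rewrite (sym_connect_sym (subgr_adj_sym T)) (cT _ y (leqnn _)).
Qed.

Lemma kappa_gt0 G S : connected_graph G -> 0 < kappa G S.
Proof.
move=> /(exists_spanning_tree S)[T TS].
rewrite /kappa (bigD1 [set T]) /= ?cards1 ?leq_max //.
apply/andP; split; first by apply/forall_inP=> T'; rewrite inE => /eqP->.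
apply/forall_inP=> T1; rewrite inE => /eqP->.
by apply/forall_inP=> T2; rewrite inE => /eqP->; rewrite eqxx.
Qed.

Lemma gen_connectivity_gt0 k G : k <= #|V| -> connected_graph G ->
  0 < gen_connectivity k G.
Proof.
move=> kn cG; rewrite /gen_connectivity cG.
elim/big_ind: _ => [|m1 m2 h1 h2|S _]; last exact: kappa_gt0.
  (* The starting value of the iterated minimum must be positive as well: it is a maximum over the
     [k]-subsets, and [k <= #|V|] provides one. *)
  have /card_gt0P[S] : 0 < #|[set S : {set V} | #|S| == k]|.
    by rewrite card_draws bin_gt0.
  rewrite inE => Sk; rewrite (bigD1 S) //= leq_max.
  by rewrite kappa_gt0.
by rewrite leq_min h1.
Qed.

Lemma gen_connectivity_compl_sum_gt0 k G : 0 < #|V| -> k <= #|V| ->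
  0 < gen_connectivity k G + gen_connectivity k (compl_graph G).
Proof.
move=> n0 kn; have /orP[cG|cG] := connected_or_compl G n0.
  by rewrite addn_gt0 gen_connectivity_gt0.
by rewrite addn_gt0 orbC gen_connectivity_gt0.
Qed.

End Counting.

(** * The path on four vertices, and the theorem *)

Definition path4_adj : rel 'I_4 := [rel x y : 'I_4 | (x.+1 == y) || (y.+1 == x)].

Lemma path4_sym : symmetric path4_adj.
Proof. by move=> x y; rewrite /path4_adj /= orbC. Qed.

Lemma path4_irr : irreflexive path4_adj.
Proof. by move=> x; rewrite /path4_adj /= orbb; lia. Qed.

Definition path4 : sgraph 'I_4 := SGraph path4_sym path4_irr.

Lemma connected_of_path (V : finType) (G : sgraph V) (x : V) (s : seq V) :
  path G x s -> (forall y, y \in x :: s) -> connected_graph G.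
Proof. by move=> es sV; apply: (@connected_from _ _ x) => y; apply: path_connect es _ (sV y). Qed.

Lemma path4_connected : connected_graph path4.
Proof.
apply: (@connected_of_path _ _ (inord 0) [:: inord 1; inord 2; inord 3]).
  by rewrite /= /path4_adj /= !inordK.
by case=> [[|[|[|[|//]]]] ?]; rewrite !inE -!val_eqE /= !inordK.
Qed.

Lemma path4_compl_connected : connected_graph (compl_graph path4).
Proof.
(* The complement of the path 0, 1, 2, 3 is the path 2, 0, 3, 1. *)
apply: (@connected_of_path _ _ (inord 2) [:: inord 0; inord 3; inord 1]).
  by rewrite /= /compl_adj /= /path4_adj -!val_eqE /= !inordK.
by case=> [[|[|[|[|//]]]] ?]; rewrite !inE -!val_eqE /= !inordK.
Qed.

Theorem theorem6 :
  (forall (n k : nat) (V : finType) (G : sgraph V),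
     2 <= k -> k <= n -> #|V| = n ->
     (1 <= gen_connectivity k G + gen_connectivity k (compl_graph G)
        <= n - uphalf k)
     /\ (0 <= ((gen_connectivity k G * gen_connectivity k (compl_graph G))%:R : rat)
           <= ((n%:R - (uphalf k)%:R) / 2%:R) ^+ 2)%R)
  /\ (exists (n k : nat) (V : finType) (G : sgraph V),
        [/\ 2 <= k, k <= n, #|V| = n &
            gen_connectivity k G + gen_connectivity k (compl_graph G) = 1])
  /\ (exists (n k : nat) (V : finType) (G : sgraph V),
        [/\ 2 <= k, k <= n, #|V| = n &
            gen_connectivity k G + gen_connectivity k (compl_graph G)
              = n - uphalf k])
  /\ (exists (n k : nat) (V : finType) (G : sgraph V),
        [/\ 2 <= k, k <= n, #|V| = n &
            gen_connectivity k G * gen_connectivity k (compl_graph G) = 0])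
  /\ (exists (n k : nat) (V : finType) (G : sgraph V),
        [/\ 2 <= k, k <= n, #|V| = n &
            ((gen_connectivity k G * gen_connectivity k (compl_graph G))%:R
              = ((n%:R - (uphalf k)%:R) / 2%:R) ^+ 2 :> rat)%R]).
Proof.
have bounds n k (V : finType) (G : sgraph V) : 2 <= k -> k <= n -> #|V| = n ->
    1 <= gen_connectivity k G + gen_connectivity k (compl_graph G) <= n - uphalf k.
  move=> k2 kn Vn; rewrite -Vn in kn *.
  by rewrite gen_connectivity_compl_sum ?gen_connectivity_compl_sum_gt0 //; lia.
split.
  move=> n k V G k2 kn Vn; have := bounds n k V G k2 kn Vn.
  move: (gen_connectivity k G) (gen_connectivity k (compl_graph G)) => a b ab; split=> //.
  rewrite Num.Theory.ler0n /=; case/andP: ab => _ ab.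
  (* The arithmetic-geometric mean inequality 4ab <= (a + b)^2, followed by the bound on the sum. *)
  have: 4 * (a * b) <= (n - uphalf k) ^ 2.
    by apply: leq_trans (nat_AGM2 a b).1 _; rewrite leq_sqr.
  rewrite -(Num.Theory.ler_nat rat) GRing.natrX GRing.natrB; last by lia.
  by rewrite !GRing.natrM; lra.
(* For n = k = 2 the bounds force the sum to be 1, so one of the two factors is 0. This settles
   three of the four equalities. *)
pose G2 := @SGraph 'I_2 (fun _ _ => false) (fun _ _ => erefl) (fun _ => erefl).
have sum2 := bounds 2 2 _ G2 isT isT (card_ord 2).
split; first by exists 2, 2, 'I_2, G2; split; rewrite ?card_ord //; lia.
split; first by exists 2, 2, 'I_2, G2; split; rewrite ?card_ord //; lia.
split; first by exists 2, 2, 'I_2, G2; split; rewrite ?card_ord //; nia.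
(* Here n - [uphalf k] = 2. Both graphs are connected, so both terms are at least 1 with sum at most
   2; each equals 1, and the bound is (2/2)^2 = 1. *)
exists 4, 3, 'I_4, path4; split; rewrite ?card_ord //.
have := bounds 4 3 _ path4 isT isT (card_ord 4).
have := @gen_connectivity_gt0 _ 3 path4.
have := @gen_connectivity_gt0 _ 3 (compl_graph path4).
rewrite card_ord path4_connected path4_compl_connected => /(_ isT isT) b0 /(_ isT isT) a0 ab.
have -> : gen_connectivity 3 path4 = 1 by lia.
have -> : gen_connectivity 3 (compl_graph path4) = 1 by lia.
by rewrite /=; lra.
Qed.
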